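(* Let $t\ge 4$ and let $G$ be a dense $3$-graph which is $C^3_t$-free and contains a subgraph isomorphic to $K^{3-}_{2t-2}$. Then $\lambda(G)\le\lambda(K^3_{2t-1})$.
   Context: For a $3$-graph $G$ on $[n]$, $\lambda(G)=\max\{\sum_{e\in E(G)}\prod_{i\in e}x_i: x_i\ge0,\ \sum_ix_i=1\}$ is its Lagrangian. An $r$-graph $G$ is dense if $\lambda(G')<\lambda(G)$ for every proper subgraph $G'$ of $G$. $C^3_t$ is the $3$-uniform linear cycle of length $t$, the $3$-graph with edges $\{1,2,3\},\{3,4,5\},\dots,\{2t-1,2t,1\}$ on $2t$ vertices. $K^3_m$ is the complete $3$-graph on $m$ vertices and $K^{3-}_m$ is $K^3_m$ with one edge removed. $G$ is $F$-free if it has no subgraph isomorphic to $F$. *)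

(* Defs.v *)
From HB Require Import structures.
From mathcomp Require Import all_boot all_order all_algebra.
From mathcomp Require Import all_classical all_reals all_analysis.

Set Implicit Arguments.
Unset Strict Implicit.
Unset Printing Implicit Defensive.

Import Order.TTheory GRing.Theory Num.Theory.
Import numFieldNormedType.Exports.

Local Open Scope ring_scope.

(* The vertex set is a field of the graph, so that all subgraphs of G, including
   those on fewer vertices, live on the same type T as G. *)
Record hypergraph (T : finType) := Hypergraph {
  verts : {set T};
  edges : {set {set T}};
  edges_sub : edges \subset powerset verts }.

Section Hypergraphs.
Variable T : finType.
Implicit Types G H : hypergraph T.

Definition uniform (r : nat) G := [forall e in edges G, #|e| == r].

Definition subgraph H G :=
  (verts H \subset verts G) && (edges H \subset edges G).

Definition proper_subgraph H G := subgraph H G && ~~ subgraph G H.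

Lemma del_edge_sub G (e : {set T}) : edges G :\ e \subset powerset (verts G).
Proof. exact: fintype.subset_trans (finset.subsetDl _ _) (edges_sub G). Qed.

Definition del_edge G (e : {set T}) := Hypergraph (del_edge_sub G e).

End Hypergraphs.

Definition isomorphic (S T : finType) (F : hypergraph S) (H : hypergraph T) :=
  exists f : S -> T,
    [/\ {in verts F &, injective f},
        f @: verts F = verts H
      & [set f @: e | e : {set S} in edges F] = edges H].

Definition has_copy (S T : finType) (F : hypergraph S) (G : hypergraph T) :=
  exists2 H : hypergraph T, subgraph H G & isomorphic F H.

Definition copy_free (S T : finType) (F : hypergraph S) (G : hypergraph T) :=
  ~ has_copy F G.

Lemma sub_powersetT (T : finType) (E : {set {set T}}) :
  E \subset powerset [set: T].
Proof. by rewrite finset.powersetT finset.subsetT. Qed.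

Definition full_hypergraph (T : finType) (E : {set {set T}}) : hypergraph T :=
  Hypergraph (sub_powersetT E).

Definition complete_hypergraph (r m : nat) : hypergraph 'I_m :=
  full_hypergraph [set e : {set 'I_m} | #|e| == r].

(* K^{3-}_m: by symmetry any edge may be removed; for 3 <= m we remove the edge
   {0, 1, 2}. *)
Definition complete3_minus (m : nat) : hypergraph 'I_m :=
  del_edge (complete_hypergraph 3 m) [set v : 'I_m | (v < 3)%N].

(* With vertices numbered from 0, the i-th edge is {2i, 2i+1, 2i+2}, the last
   vertex being read modulo 2t. *)
Definition linear_cycle3 (t : nat) : hypergraph 'I_(2 * t) :=
  full_hypergraph
    [set [set v : 'I_(2 * t) | (v : nat) \in
            [:: 2 * i; 2 * i + 1; (2 * i + 2) %% (2 * t)]%N] | i : 'I_t].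

Section Lagrangian.
Variables (R : realType) (T : finType).
Implicit Types (G : hypergraph T) (x : T -> R).

Definition weighting G x :=
  (forall i, i \in verts G -> 0 <= x i) /\ \sum_(i in verts G) x i = 1.

Definition lagrange_poly G x : R := \sum_(e in edges G) \prod_(i in e) x i.

(* The supremum is a maximum as soon as G has a vertex: see lagrangian_attained
   and lagrangian_ub. Without vertices there is no weighting and the value is 0. *)
Definition lagrangian G : R :=
  sup [set lagrange_poly G x | x in weighting G]%classic.

Definition lagrangian_dense G :=
  forall H : hypergraph T, proper_subgraph H G -> lagrangian H < lagrangian G.

Lemma lagrangian_max G : verts G != finset.set0 ->
  exists2 x, weighting G x &
    forall y, weighting G y -> lagrange_poly G y <= lagrange_poly G x.
Proof.
move=> /set0Pn[i0 i0G].
pose X (v : 'rV[R]_#|T|) (i : T) : R := v ord0 (enum_rank i).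
pose V x : 'rV[R]_#|T| := \row_j (if enum_val j \in verts G then x (enum_val j) else 0).
have VX x i : i \in verts G -> X (V x) i = x i.
  by move=> iG; rewrite /X mxE enum_rankK iG.
have polyV x : lagrange_poly G (X (V x)) = lagrange_poly G x.
  apply: eq_bigr => e eG; apply: eq_bigr => i ie; apply: VX.
  by move/fintype.subsetP: (edges_sub G) => /(_ _ eG); rewrite powersetE => /fintype.subsetP; apply.
have wV x : weighting G x -> weighting G (X (V x)).
  case=> x0 x1; split=> [i iG|]; first by rewrite VX // x0.
  by rewrite -[RHS]x1; apply: eq_bigr => i; apply: VX.
have x01 x : weighting G x -> forall j, 0 <= V x ord0 j <= 1.
  case=> x0 x1 j; rewrite mxE; case: ifPn => [jG|_]; last by rewrite lexx ler01.
  rewrite x0 //= -x1 (bigD1 (enum_val j)) //= lerDl sumr_ge0 // => i /andP[iG _].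
  exact: x0.
have cX i : continuous (fun v : 'rV[R]_#|T| => X v i) by exact: coord_continuous.
pose sumX (v : 'rV[R]_#|T|) : R := \sum_(i in verts G) X v i.
have csum : continuous sumX.
  apply: continuous_big => [|i _]; [exact: add_continuous|exact: cX].
have cpoly : continuous (fun v => lagrange_poly G (X v)).
  apply: continuous_big => [|e _]; first exact: add_continuous.
  by apply: continuous_big => [|i _]; [exact: mul_continuous|exact: cX].
pose B := [set v : 'rV[R]_#|T| | forall j, (`[0, 1]%classic : set R) (v ord0 j)]%classic.
pose A := (B `&` (sumX @^-1` [set 1]))%classic.
have cptB : compact B.
  exact: (@rV_compact R #|T| (fun=> `[0, 1]%classic)
    (fun=> @segment_compact R 0 1)).
have cA : compact A.
  apply: (@subclosed_compact _ A B) => //.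
  - apply: closedI; first by apply: compact_closed => //; exact: norm_hausdorff.
    by apply: preimage_closed; [move=> v _; exact: csum|exact: closed_eq].
  - by move=> v [].
have AV x : weighting G x -> A (V x).
  move=> wx; split=> [j|]; first by rewrite /= in_itv /= x01.
  by have [] := wV _ wx.
have w0 : weighting G (fun i => (i == i0)%:R).
  split=> [i _|]; first by rewrite ler0n.
  rewrite (bigD1 i0) //= eqxx big1 ?addr0 // => i /andP[_ /negbTE->] //.
have A0 : (A !=set0)%classic by exists (V (fun i => (i == i0)%:R)); exact: AV.
have [c /set_mem[cB cs] cmax] :=
  EVT_max_rV A0 cA (continuous_subspaceT cpoly).
exists (X c) => [|y wy].
  by split=> [i _|//]; have := cB (enum_rank i); rewrite /= in_itv /= => /andP[].
by rewrite -polyV; apply: cmax; apply/mem_set/AV.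
Qed.

Lemma lagrangian_attained G : verts G != finset.set0 ->
  exists2 x, weighting G x & lagrange_poly G x = lagrangian G.
Proof.
move=> /lagrangian_max[x wx xmax]; exists x => //.
apply/eqP; rewrite eq_le; apply/andP; split.
  by apply: ub_le_sup; [exists (lagrange_poly G x) => _ [y wy <-]; exact: xmax|exists x].
by apply: ge_sup; [exists (lagrange_poly G x), x|move=> _ [y wy <-]; exact: xmax].
Qed.

Lemma lagrangian_ub G x : weighting G x -> lagrange_poly G x <= lagrangian G.
Proof.
move=> wx; have /lagrangian_max[z wz zmax] : verts G != finset.set0.
  apply/eqP => G0; case: wx => _; rewrite G0 big_set0 => /esym/eqP.
  by rewrite oner_eq0.
by apply: ub_le_sup; [exists (lagrange_poly G z) => _ [y wy <-]; exact: zmax|exists x].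
Qed.

End Lagrangian.

Arguments lagrangian R {T} G.
Arguments lagrangian_dense R {T} G.

(* Main.v *)
(* Let S be the vertex set of the copy of K^{3-}_{2t-2}.  A path of two or three
   edges through two to five vertices outside S, with both ends in S, closes up
   inside S to a linear cycle C^3_t, the missing edge being avoidable.  In a dense
   graph any two vertices lie in a common edge, so forbidding these cycles leaves
   little freedom: at most one vertex w outside S is joined to more than one pair
   of S, and the others split into pairs {u, phi u} such that every edge not
   contained in A = S + w contains one of the pairs.  As |A| <= 2t - 1, the edges
   inside A contribute at most c a^3, where c = lambda(K^3_{2t-1}) and a is the
   weight of A, and the others at most
   sum_{pairs} p^2 (1 - p) / 4 <= (1 - a) / 16, p being the weight of a pair.
   Since c >= 1/16, the total is at most c a + c (1 - a) = c. *)
Require Import Defs.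
From mathcomp Require Import all_boot all_order all_algebra.
From mathcomp Require Import all_classical all_reals all_analysis.
From mathcomp Require Import finset.
From mathcomp Require Import zify ring lra.

Set Implicit Arguments.
Unset Strict Implicit.
Unset Printing Implicit Defensive.

Import Order.TTheory GRing.Theory Num.Theory.

Local Open Scope ring_scope.

Lemma cards3 (T : finType) (x y z : T) :
  (#|[set x; y; z]| == 3)%N = [&& x != y, x != z & y != z].
Proof.
rewrite finset.setUC cardsU1 cards2 !inE negb_or ![z == _]eq_sym.
by case: (x == y); case: (x == z); case: (y == z).
Qed.

(** * Linear paths and cycles *)

Section LinearPaths.
Local Open Scope nat_scope.
Variables (T : finType) (E : {set {set T}}).

(** The list [s] gives the vertices after [b], two per edge, the second of them starting the next
    edge; a path with k edges has [size s] equal to 2k. Distinctness is kept apart, as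
    [uniq (b :: s)]. *)
Fixpoint linear_path (b : T) (s : seq T) : bool :=
  match s with
  | [::] => true
  | p :: q :: s' => ([set b; p; q] \in E) && linear_path q s'
  | _ => false
  end.

Lemma linear_path_cat b s1 s2 :
  linear_path b s1 -> linear_path (last b s1) s2 -> linear_path b (s1 ++ s2).
Proof.
have [n] := ubnP (size s1); elim: n s1 b => // n IH [|p [|q s1]] b //= lt_n.
by move=> /andP[-> p1] p2 /=; apply: IH => //; lia.
Qed.

Lemma linear_path_nth d b s i : linear_path b s -> 2 * i + 2 <= size s ->
  [set nth d (b :: s) (2 * i); nth d (b :: s) (2 * i + 1);
       nth d (b :: s) (2 * i + 2)] \in E.
Proof.
elim: i b s => [|i IH] b [|p [|q s]] //; first by case/andP.
have -> : 2 * i.+1 = (2 * i).+2 by lia.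
move=> /andP[_ ps] lt_i.
by apply: (IH q s) => //; lia.
Qed.

Lemma linear_path_sub (X : {set T}) b s :
    (forall e : {set T}, e \subset X -> #|e| = 3 -> e \in E) ->
    ~~ odd (size s) -> uniq (b :: s) -> {subset b :: s <= X} ->
  linear_path b s.
Proof.
move=> XE; have [n] := ubnP (size s); elim: n s b => // n IH [|p [|q s]] b //=.
rewrite !inE !negb_or negbK -!andbA.
move=> lt_n ev_s /and5P[bp bq bs pq] /and3P[ps qs us] sX.
apply/andP; split; last first.
  apply: IH; rewrite ?negbK //=; [lia | by rewrite qs |].
  move=> z zs; apply: sX; rewrite !inE; move: zs; rewrite inE.
  by case/orP => ->; rewrite !orbT.
apply: XE.
  apply/fintype.subsetP => z; rewrite !inE -orbA => /or3P[] /eqP ->; apply: sX;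
  by rewrite !inE eqxx ?orbT.
by apply/eqP; rewrite cards3 bp bq pq.
Qed.

End LinearPaths.

(** The cycle is a closed path: [d] is repeated at the end, so that the index reduced modulo [2 * t]
    and the plain index read the same vertex. *)
Lemma linear_cycle_copy (T : finType) (G : hypergraph T) (t : nat) (d : T) s :
    uniq (d :: s) -> (size s).+1 = (2 * t)%N ->
    linear_path (edges G) d (rcons s d) ->
  has_copy (linear_cycle3 t) G.
Proof.
move=> us sz ps; pose c := d :: rcons s d.
pose f (i : 'I_(2 * t)) := nth d c i.
have fE i : f i = nth d (d :: s) i.
  rewrite /f /c -rcons_cons nth_rcons /=; case: ifP => // /negbT.
  by have := ltn_ord i; lia.
have finj : injective f.
  move=> i j; rewrite !fE => /eqP; rewrite nth_uniq //= ?sz ?ltn_ord //.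
  by move=> /eqP/val_inj.
have cE (i : 'I_t) : [set nth d c (2 * i); nth d c (2 * i + 1);
    nth d c (2 * i + 2)] \in edges G.
  by apply: linear_path_nth; rewrite // size_rcons sz; have := ltn_ord i; lia.
have c0 : nth d c (2 * t) = nth d c 0.
  by rewrite /c -sz /= nth_rcons ltnn eqxx.
have fe (i : 'I_t) : f @: [set v : 'I_(2 * t) | (v : nat) \in
      [:: 2 * i; 2 * i + 1; (2 * i + 2) %% (2 * t)]%N] =
    [set nth d c (2 * i); nth d c (2 * i + 1); nth d c (2 * i + 2)].
  have ti := ltn_ord i.
  have t0 : (0 < 2 * t)%N by lia.
  have cm : nth d c ((2 * i + 2) %% (2 * t)) = nth d c (2 * i + 2).
    have [lt|le] := ltnP (2 * i + 2) (2 * t); first by rewrite modn_small.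
    by have -> : (2 * i + 2 = 2 * t)%N by [lia]; rewrite modnn c0.
  apply/setP => y; rewrite !inE; apply/imsetP/idP => [[v]|].
    rewrite !inE => /or3P[] /eqP vE ->; rewrite /f vE ?cm eqxx ?orbT //.
  rewrite -orbA => yc.
  have [k [kt kc ->]] : exists k, [/\ (k < 2 * t)%N,
      k \in [:: 2 * i; 2 * i + 1; (2 * i + 2) %% (2 * t)]%N & y = nth d c k].
    case/or3P: yc => /eqP ->; [exists (2 * i)%N | exists (2 * i + 1)%N |
      exists ((2 * i + 2) %% (2 * t))%N]; split; rewrite ?inE ?eqxx ?orbT //.
    - by lia.
    - by lia.
    - by rewrite ltn_mod.
  by exists (Ordinal kt); rewrite ?inE //= in kc *.
have HE : [set f @: e | e : {set 'I_(2 * t)} in edges (linear_cycle3 t)]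
    \subset edges G.
  by apply/fintype.subsetP => _ /imsetP[_ /imsetP[i _ ->] ->]; rewrite fe.
have HV : [set f @: e | e : {set 'I_(2 * t)} in edges (linear_cycle3 t)]
    \subset powerset [set f i | i in 'I_(2 * t)].
  apply/fintype.subsetP => _ /imsetP[e _ ->]; rewrite powersetE.
  by apply: imsetS; apply/fintype.subsetP.
exists (Hypergraph HV); last first.
  exists f; split=> //=; first by move=> i j _ _; exact: finj.
  by apply/setP => y; apply/imsetP/imsetP => -[i _ ->]; exists i; rewrite ?inE.
rewrite /subgraph /= HE andbT; apply/fintype.subsetP => _ /imsetP[v _ ->].
(* Vertex number [v] of the cycle lies on edge number [v./2], hence in [verts G]. *)
have vt : (v./2 < t)%N by have := ltn_ord v; lia.
have /fintype.subsetP/(_ _ (cE (Ordinal vt))) := edges_sub G.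
rewrite powersetE => /fintype.subsetP; apply; rewrite !inE /f /=.
have vE := odd_double_half v.
case: (odd v) vE => vE.
  by have <- : (v = 2 * v./2 + 1 :> nat)%N by [lia]; rewrite eqxx ?orbT.
by have <- : (v = 2 * v./2 :> nat)%N by [lia]; rewrite eqxx ?orbT.
Qed.

Lemma cardsD2 (T : finType) (D : {set T}) p q :
  p \in D -> q \in D -> q != p -> #|D :\ p :\ q|.+2 = #|D|.
Proof.
move=> pD qD qp; have qDp : q \in D :\ p by rewrite !inE qp qD.
by rewrite [RHS](cardsD1 p) pD [#|D :\ p|](cardsD1 q) qDp.
Qed.

(** * Closing linear paths to cycles *)

Section ClosingPaths.
Local Open Scope nat_scope.
Variables (T : finType) (G : hypergraph T) (t : nat).
Local Notation E := (edges G).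

(** The [j] closing edges need [2 * j - 1] new inner vertices, taken from [D] in any order; with the
    [size P + 1] vertices of the path this makes [2 * t]. *)
Lemma close_linear_path (a : T) (P : seq T) (D : {set T}) (j : nat) :
    uniq (a :: P) -> linear_path E a P -> last a P != a ->
    {in D, forall z, z \notin a :: P} ->
    0 < j -> size P + 2 * j = 2 * t -> 2 * j - 1 <= #|D| ->
    (forall e : {set T}, e \subset [set a; last a P] :|: D -> #|e| = 3 ->
       e \in E) ->
  has_copy (linear_cycle3 t) G.
Proof.
move=> uP pP ba DP j0 sz cD DE; pose ds := take (2 * j - 1) (enum D).
have sds : size ds = 2 * j - 1 by rewrite size_takel // -cardE.
have uds : uniq ds by rewrite take_uniq ?enum_uniq.
have dsD z : z \in ds -> z \in D by move/mem_take; rewrite mem_enum.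
have hds : ~~ has (mem (a :: P)) ds.
  by apply/hasPn => z /dsD /DP.
apply: (@linear_cycle_copy _ _ _ a (P ++ ds)).
- by rewrite -cat_cons cat_uniq uP uds hds.
- by rewrite size_cat sds; lia.
rewrite rcons_cat; apply: linear_path_cat => //.
apply: (linear_path_sub DE).
- by rewrite size_rcons sds; lia.
- rewrite /= mem_rcons inE negb_or ba rcons_uniq uds andbT /=.
  have nin z : z \in a :: P -> z \notin ds.
    by move=> zP; apply: contraL zP => /dsD/DP.
  by rewrite !nin ?mem_head ?mem_last.
- move=> z; rewrite inE mem_rcons inE !inE => /or3P[-> | -> | /dsD ->];
  by rewrite ?orbT.
Qed.

Variables (S f : {set T}).
Hypothesis f3 : #|f| = 3.
Hypothesis SE : forall e : {set T}, e \subset S -> #|e| = 3 -> e != f -> e \in E.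

(* The next edge [{last a P, p, q}] is chosen different from [f] but so that
   some vertex of [f] becomes unavailable; [f] then no longer matters. *)
Lemma close_linear_path_avoiding (a : T) (P : seq T) (D : {set T}) (j : nat) :
    uniq (a :: P) -> linear_path E a P -> last a P != a ->
    a \in S -> last a P \in S -> D \subset S ->
    {in D, forall z, z \notin a :: P} ->
    1 < j -> size P + 2 * j = 2 * t -> 2 * j - 1 <= #|D| ->
  has_copy (linear_cycle3 t) G.
Proof.
set b := last a P => uP pP ba aS bS DS DP j1 sz cD.
have D0 : 0 < #|D| by lia.
have aD : a \notin D by apply: contraT => /negPn/DP; rewrite mem_head.
have bD : b \notin D by apply: contraT => /negPn/DP; rewrite mem_last.
have other p : p \in D -> exists2 q, q \in D & q != p.
  move=> pD; have : 0 < #|D :\ p| by move: cD; rewrite (cardsD1 p) pD; lia.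
  by move=> /card_gt0P[q]; rewrite !inE => /andP[qp qD]; exists q.
have [p [q [pD qD pq bpq [r rf]]]] : exists p q, [/\ p \in D, q \in D, q != p,
    [set b; p; q] != f & exists2 r, r \in f &
      r \notin [set a; q] :|: (D :\ p :\ q)].
  (* If [b] is in [f], the step away from [b] uses up a vertex of [f]; some [p] outside [f] exists
     because [D] has at least three vertices and [f] only two besides [b]. *)
  have [bf|bf] := boolP (b \in f).
    have /fintype.subsetPn[p pD pf] : ~~ (D \subset f).
      apply/negP => Df; have : D \subset f :\ b.
        apply/fintype.subsetP => z zD; rewrite !inE (fintype.subsetP Df) // andbT.
        by apply: contraNneq bD => <-.
      by move/subset_leq_card; have := cardsD1 b f; rewrite bf f3; lia.
    have [q qD qp] := other p pD; exists p, q; split => //.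
      by apply: contraNneq pf => <-; rewrite !inE eqxx orbT.
    exists b => //; rewrite !inE (negPf ba) (negPf bD) !andbF !orbF /=.
    by apply: contraNneq bD => ->.
  have bN p q : [set b; p; q] != f.
    by apply: contraNneq bf => <-; rewrite !inE eqxx.
  have [|fa] := boolP (f \subset [set a]).
    by move/subset_leq_card; rewrite f3 cards1.
  have [r rf ra] := fintype.subsetPn fa.
  have [rD|rD] := boolP (r \in D).
    have [q qD qp] := other r rD; exists r, q; split => //; exists r => //.
    by rewrite !inE [r == q]eq_sym (negPf qp) eqxx andbF !orbF; rewrite inE in ra.
  have /card_gt0P[p pD] := D0.
  have [q qD qp] := other p pD; exists p, q; split => //; exists r => //.
  rewrite !inE (negPf rD) !andbF orbF; rewrite inE in ra; rewrite (negPf ra) /=.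
  by apply: contraNneq rD => ->.
move=> rX.
have DqE := cardsD2 pD qD pq.
apply: (@close_linear_path a (P ++ [:: p; q]) (D :\ p :\ q) j.-1).
- rewrite -cat_cons cat_uniq uP /= !inE [p == q]eq_sym pq andbT orbF /=.
  by have := DP _ pD; have := DP _ qD; rewrite !inE => /negPf -> /negPf ->.
- apply: linear_path_cat => //=; rewrite andbT; apply: SE => //.
    by apply/fintype.subsetP => z; rewrite !inE -orbA => /or3P[] /eqP -> //;
      apply: (fintype.subsetP DS).
  apply/eqP; rewrite cards3 [p == q]eq_sym pq andbT.
  by apply/andP; split; apply: contraNneq bD => bE; rewrite /b bE.
- by rewrite last_cat /=; apply: contraNneq aD => <-.
- move=> z; rewrite !inE mem_cat !inE => /and3P[zq zp /DP].
  by rewrite !inE !negb_or zq zp andbT => /andP[-> ->].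
- by clear -j1; lia.
- by rewrite size_cat /=; clear -j1 sz; lia.
- by clear -cD DqE; lia.
rewrite last_cat /= => e eX e3; apply: SE => //.
  apply: fintype.subset_trans eX _; apply/fintype.subsetP => z; rewrite !inE.
  by case/orP => [/orP[]/eqP -> //|/and3P[_ _]]; apply: (fintype.subsetP DS).
by apply: contraNneq rX => ef; apply: (fintype.subsetP eX); rewrite ef.
Qed.

End ClosingPaths.

Lemma leq_card_setD (T : finType) (A B : {set T}) :
  (#|A| <= #|A :\: B| + #|B|)%N.
Proof. by rewrite cardsD; have := subset_leq_card (subsetIr A B); lia. Qed.

(** * Vertices outside a clique minus an edge *)

Section CliqueMinusEdge.
Local Open Scope nat_scope.
Variables (T : finType) (G : hypergraph T) (t : nat) (S f : {set T}).
Hypotheses (ht : 4 <= t) (hG : uniform 3 G).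
Hypothesis hfree : copy_free (linear_cycle3 t) G.
Hypothesis hcov : {in verts G &, forall u v, u != v ->
  exists2 e, e \in edges G & (u \in e) && (v \in e)}.
Hypotheses (SG : S \subset verts G) (cS : #|S| = 2 * t - 2).
Hypotheses (fS : f \subset S) (f3 : #|f| = 3).
Hypothesis SE : forall e : {set T}, e \subset S -> #|e| = 3 -> e != f ->
  e \in edges G.
Local Notation E := (edges G).

Lemma set3C (x y z : T) : [set x; y; z] = [set y; x; z].
Proof. by rewrite [[set x; y]]finset.setUC. Qed.

Lemma set3AC (x y z : T) : [set x; y; z] = [set x; z; y].
Proof. by rewrite -!finset.setUA [[set y; z]]finset.setUC. Qed.

Lemma edge_uniq x y z : [set x; y; z] \in E -> [&& x != y, x != z & y != z].
Proof. by move/(forall_inP hG); rewrite cards3. Qed.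

Lemma edge_verts e x : e \in E -> x \in e -> x \in verts G.
Proof.
move=> eE; have := fintype.subsetP (edges_sub G) e eE.
by rewrite powersetE => /fintype.subsetP; apply.
Qed.

Lemma edge_third e x y : e \in E -> x \in e -> y \in e -> x != y ->
  exists z, e = [set x; y; z].
Proof.
move=> eE xe ye xy; have e3 := eqP (forall_inP hG e eE).
have : #|e :\ x :\ y| == 1.
  by have := cardsD2 xe ye; rewrite eq_sym xy e3 => /(_ isT)[->].
case/cards1P => z zE; exists z; apply/setP => w.
have := congr1 (fun A : {set T} => w \in A) zE; rewrite !inE => <-.
case: (eqVneq w x) => [->|_]; first by rewrite xe.
by case: (eqVneq w y) => [->|_]; first by rewrite ye.
Qed.

(** Taking for [D] the vertices of [S] off the path reduces closing a cycle to counting how many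
    vertices of [S] the path uses. *)
Lemma close_in_clique (a : T) (P : seq T) (j : nat) :
    uniq (a :: P) -> linear_path E a P -> last a P != a ->
    a \in S -> last a P \in S ->
    1 < j -> size P + 2 * j = 2 * t ->
    2 * j - 1 + count [in S] (a :: P) <= #|S| -> False.
Proof.
move=> uP pP ba aS bS j1 sz cnt; apply: hfree.
have uf : uniq [seq x <- a :: P | x \in S] by rewrite filter_uniq.
apply: (close_linear_path_avoiding f3 SE uP pP ba (D := S :\: [set x in a :: P])
  (j := j)) => //.
- exact: finset.subsetDl.
- by move=> z; rewrite !inE => /andP[].
rewrite cardsD.
have -> : S :&: [set x in a :: P] = [set x in [seq x <- a :: P | x \in S]].
  by apply/setP => x; rewrite !inE mem_filter inE.
by rewrite cardsE (card_uniqP uf) size_filter; clear -cnt; lia.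
Qed.

(** * Edge configurations around the clique that close to a cycle *)

Lemma outside_neq u s : u \notin S -> s \in S -> u != s.
Proof. by move=> uS sS; apply: contraNneq uS => ->. Qed.

Ltac distinct :=
  rewrite /= ?inE ?negb_or; repeat (apply/andP; split); try done;
  first [by rewrite eq_sym | by rewrite outside_neq
        | by rewrite eq_sym outside_neq].

(** The path a, u, b, v, d takes three of the 2t - 2 vertices of [S], and the 2t - 5 left are just
    enough for t - 2 closing edges. *)
Lemma link_adjacent u v a b d : u \notin S -> v \notin S -> u != v ->
    a \in S -> b \in S -> d \in S -> a != d ->
    [set u; a; b] \in E -> [set v; b; d] \in E -> False.
Proof.
move=> uS vS uv aS bS dS ad uab vbd.
have /and3P[ua ub ab] := edge_uniq uab; have /and3P[vb vd bd] := edge_uniq vbd.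
apply: (@close_in_clique a [:: u; b; v; d] (t - 2)); rewrite //=.
- by distinct.
- by rewrite set3C uab set3C vbd.
- by rewrite eq_sym.
- by clear -ht; lia.
- by clear -ht; lia.
by rewrite aS bS dS (negPf uS) (negPf vS) cS; clear -ht; lia.
Qed.

(** An edge {b, p, c} joins the two given ones into a path with five vertices in [S], leaving 2t - 7
    for t - 3 closing edges. For t = 4 a single edge closes the cycle, so [close_in_clique] does not
    apply and the choice of [p] has to take care of [f]. *)
Lemma link_disjoint u v a b c d : u \notin S -> v \notin S -> u != v ->
    a \in S -> b \in S -> c \in S -> d \in S ->
    a != c -> a != d -> b != c -> b != d ->
    [set u; a; b] \in E -> [set v; c; d] \in E -> False.
Proof.
move=> uS vS uv aS bS cS' dS ac ad bc bd uab vcd.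
have /and3P[ua ub ab] := edge_uniq uab; have /and3P[vc vd cd] := edge_uniq vcd.
pose X := S :\: [set x in [:: a; b; c; d]].
have cX : 2 * t - 6 <= #|X|.
  have := leq_card_setD S [set x in [:: a; b; c; d]].
  have : #|[set x in [:: a; b; c; d]]| <= 4 by rewrite cardsE; apply: card_size.
  by rewrite -/X cS; clear -ht; lia.
(* Since [b], [c] and [p] are not ends of the path, having a vertex [r] of [f] among them keeps [f]
   away from the closing edges. *)
have [p [pX bpc [r rf rb]]] : exists p, [/\ p \in X, [set b; p; c] != f &
    exists2 r, r \in f & r \in [set b; c; p]].
  have /card_gt1P[p [q [pX qX pq]]] : 1 < #|X|.
    by apply: leq_trans cX; clear -ht; lia.
  have notboth : exists2 p, p \in X & [set b; p; c] != f.
    have [bpf|] := eqVneq [set b; p; c] f; last by exists p.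
    exists q => //; apply: contraNneq pq => bqf.
    have : p \in [set b; q; c] by rewrite bqf -bpf !inE eqxx orbT.
    move: pX; rewrite !inE !negb_or => /andP[/and4P[_ pb pc _] _].
    by rewrite (negPf pb) (negPf pc) orbF.
  have [bf|bf] := boolP (b \in f).
    have [p' p'X ?] := notboth; exists p'; split => //.
    by exists b => //; rewrite !inE eqxx.
  have [cf|cf] := boolP (c \in f).
    have [p' p'X ?] := notboth; exists p'; split => //.
    by exists c => //; rewrite !inE eqxx orbT.
  (* Here [f] misses [b] and [c], so a vertex of [f] outside {a, d} can itself serve as [p]. *)
  have /fintype.subsetPn[r rf] : ~~ (f \subset [set a; d]).
    by apply/negP => /subset_leq_card; rewrite f3 cards2; case: (a != d).
  rewrite !inE negb_or => /andP[ra rd]; exists r; split.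
  - rewrite !inE (negPf ra) (negPf rd) (fintype.subsetP fS) // orbF andbT /=.
    by apply/norP; split; [move: bf | move: cf]; apply: contraNneq => <-.
  - by apply: contraNneq bf => <-; rewrite !inE eqxx.
  - by exists r => //; rewrite !inE eqxx !orbT.
have [pa pb pc pd pS] : [/\ p != a, p != b, p != c, p != d & p \in S].
  by move: pX; rewrite !inE !negb_or => /andP[/and4P[]].
apply: hfree; pose D := X :\ p.
apply: (@close_linear_path _ _ _ a [:: u; b; p; c; v; d] D (t - 3)); rewrite //=.
- by distinct.
- rewrite set3C uab andbT /=; apply/andP; split; last by rewrite set3C.
  apply: SE => //; last by apply/eqP; rewrite cards3; distinct.
  by apply/fintype.subsetP => z; rewrite !inE -orbA => /or3P[] /eqP ->.
- by rewrite eq_sym.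
- move=> z; rewrite !inE !negb_or => /and3P[zp /and4P[za zb zc zd] zS].
  by distinct.
- by clear -ht; lia.
- by clear -ht; lia.
- by have := cardsD1 p X; rewrite pX -/D; clear -ht cX; lia.
move=> e eX e3; apply: SE => //.
  apply: fintype.subset_trans eX _; apply/fintype.subsetP => z.
  by rewrite !inE => /orP[/orP[]/eqP-> //|/and3P[]].
apply: contraTneq rb => ef; rewrite -ef in rf.
have := fintype.subsetP eX r rf; rewrite !inE.
case/orP => [/orP[]/eqP->|/and3P[rp]]; rewrite !negb_or.
- by distinct.
- by distinct.
by case/and4P => _ rb rc _ _; distinct.
Qed.

(** The link graph of [u] induced on [S]; when [u] is outside [S] its members are pairs, by
    3-uniformity. *)
Definition link (u : T) : {set {set T}} :=
  [set p : {set T} | (p \subset S) && (u |: p \in E)].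

Lemma link_edge u a b : a \in S -> b \in S -> [set u; a; b] \in E ->
  [set a; b] \in link u.
Proof.
move=> aS bS uab; rewrite inE finset.setUA uab andbT.
by apply/fintype.subsetP => z; rewrite !inE => /orP[] /eqP ->.
Qed.

Lemma linkP u p : u \notin S -> p \in link u ->
  exists a b, [/\ p = [set a; b], a \in S, b \in S & [set u; a; b] \in E].
Proof.
move=> uS; rewrite inE => /andP[pS upE].
have up : u \notin p by apply: contra uS; apply: (fintype.subsetP pS).
have /cards2P[a [b [ab pE]]] : #|p| == 2.
  by move/(forall_inP hG): (upE); rewrite cardsU1 up.
exists a, b; rewrite (fintype.subsetP pS) ?(fintype.subsetP pS) //;
  try by rewrite pE !inE eqxx ?orbT.
by split=> //; rewrite -finset.setUA -pE.
Qed.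

(** Pairs meeting in one vertex are excluded by [link_adjacent] and disjoint ones by
    [link_disjoint]. Hence at most one vertex outside [S] can have two link pairs. *)
Lemma link_eq u v p q : u \notin S -> v \notin S -> u != v ->
  p \in link u -> q \in link v -> p = q.
Proof.
move=> uS vS uv /(linkP uS)[a [b [-> aS bS uab]]].
case/(linkP vS)=> c [d [-> cS' dS vcd]].
have uba : [set u; b; a] \in E by rewrite set3AC.
have vdc : [set v; d; c] \in E by rewrite set3AC.
have [ac|ac] := eqVneq a c.
  rewrite -ac in vcd vdc *; have [->//|bd] := eqVneq b d.
  by case: (link_adjacent uS vS uv bS aS dS bd uba vcd).
have [ad|ad] := eqVneq a d.
  rewrite -ad in vcd vdc *; have [->|bc] := eqVneq b c; first exact: finset.setUC.
  by case: (link_adjacent uS vS uv bS aS cS' bc uba vdc).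
have [bc|bc] := eqVneq b c.
  rewrite -bc in vcd vdc *.
  by case: (link_adjacent uS vS uv aS bS dS ad uab vcd).
have [bd|bd] := eqVneq b d.
  rewrite -bd in vcd vdc *.
  by case: (link_adjacent uS vS uv aS bS cS' ac uab vdc).
by case: (link_disjoint uS vS uv aS bS cS' dS ac ad bc bd uab vcd).
Qed.

(** If [v] and [w] differed, s, v, u, w, s' would be a path with only its two ends in [S], and the
    2t - 4 other vertices of [S] would close it. *)
Lemma partner_unique u v w s s' : u \notin S -> v \notin S -> w \notin S ->
    s \in S -> s' \in S -> s != s' ->
    [set u; v; s] \in E -> [set u; w; s'] \in E -> v = w.
Proof.
move=> uS vS wS sS s'S ss' uvs uws'; apply/eqP/contraT => vw; exfalso.
have /and3P[uv us vs] := edge_uniq uvs; have /and3P[uw us' ws'] := edge_uniq uws'.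
apply: (@close_in_clique s [:: v; u; w; s'] (t - 2)); rewrite //=.
- by distinct.
- by rewrite set3C set3AC set3C uvs uws'.
- by rewrite eq_sym.
- by clear -ht; lia.
- by clear -ht; lia.
by rewrite sS s'S (negPf uS) (negPf vS) (negPf wS) cS; clear -ht; lia.
Qed.

(** The path s, u, v, a, b closes up, again with the 2t - 5 remaining vertices of [S]. *)
Lemma partner_link u v s a b : u \notin S -> v \notin S ->
    s \in S -> a \in S -> b \in S -> s != a -> s != b ->
    [set u; v; s] \in E -> [set v; a; b] \in E -> False.
Proof.
move=> uS vS sS aS bS sa sb uvs vab.
have /and3P[uv us vs] := edge_uniq uvs; have /and3P[va vb ab] := edge_uniq vab.
apply: (@close_in_clique s [:: u; v; a; b] (t - 2)); rewrite //=.
- by distinct.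
- by rewrite set3C set3AC uvs vab.
- by rewrite eq_sym.
- by clear -ht; lia.
- by clear -ht; lia.
by rewrite sS aS bS (negPf uS) (negPf vS) cS; clear -ht; lia.
Qed.

(** With s and s' in [f], the path s, u', u, z, v, v', s' is closed by vertices of [S] outside [f].
    The closing edges contain at most two vertices of [f], hence none is [f], even when t = 4 leaves
    a single closing edge. *)
Lemma partners_chain u u' v v' z :
    uniq [:: u'; u; z; v; v'] -> all [predC S] [:: u'; u; z; v; v'] ->
    {in S, forall s, [set u; u'; s] \in E} ->
    {in S, forall s, [set v; v'; s] \in E} ->
  [set u; z; v] \in E -> False.
Proof.
move=> un out uu' vv' uzv.
have [s [s' [sf s'f ss']]] : exists s s', [/\ s \in f, s' \in f & s != s'].
  by have /card_gt1P : 1 < #|f| by rewrite f3.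
have [sS s'S] : s \in S /\ s' \in S by split; apply: (fintype.subsetP fS).
apply: hfree.
apply: (@close_linear_path _ _ _ s [:: u'; u; z; v; v'; s'] (S :\: f) (t - 3));
  rewrite //=.
- have nout y : y \in S -> y \notin [:: u'; u; z; v; v'].
    by move=> yS; apply: contraL yS => /(allP out).
  have us L : uniq L -> s \notin L -> s' \notin L -> uniq (s :: rcons L s').
    by rewrite cons_uniq mem_rcons inE negb_or rcons_uniq ss' => -> -> ->.
  exact: us un (nout _ sS) (nout _ s'S).
- by rewrite [[set s; u'; u]]set3AC set3C set3AC uu' // uzv vv'.
- by rewrite eq_sym.
- move=> y; rewrite !inE => /andP[yf yS].
  have nout : y \notin [:: u'; u; z; v; v'].
    by apply: contraL yS => /(allP out).
  move: nout; rewrite !inE !negb_or => /and5P[-> -> -> -> ->].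
  by apply/andP; split; apply: contraNneq yf => ->.
- by clear -ht; lia.
- by clear -ht; lia.
- by have := leq_card_setD S f; rewrite f3 cS; clear -ht; lia.
move=> e eX e3; apply: SE => //.
  apply: fintype.subset_trans eX _; apply/fintype.subsetP => y.
  by rewrite !inE => /orP[/orP[]/eqP-> //|/andP[]].
apply/eqP => ef; rewrite ef in eX.
have : f \subset [set s; s'].
  apply/fintype.subsetP => y yf; have := fintype.subsetP eX y yf.
  by rewrite !inE yf orbF.
by move/subset_leq_card; rewrite f3 cards2; case: (s != s').
Qed.

(** A vertex [s] of [S] in no link pair of [u] shares an edge with [u], whose third vertex must be
    outside [S]; by [partner_unique] it is the same vertex [v] for all such [s]. By [partner_link]
    neither [u] nor [v] then has a link pair, so these [s] exhaust [S]. *)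
Lemma partner_exists u : u \in verts G -> u \notin S -> #|link u| <= 1 ->
  exists v, [/\ v \notin S, link u = set0, link v = set0 &
    {in S, forall s, [set u; v; s] \in E}].
Proof.
move=> uG uS lu.
pose X := S :\: cover (link u).
(* The link covers at most two vertices, which leaves at least 2t - 4 >= 4, more than a pair can
   contain. *)
have cX : 3 < #|X|.
  have : #|cover (link u)| <= 2.
    have [/eqP/cards1P[p lp]|] := eqVneq #|link u| 1.
      have pl : p \in link u by rewrite lp inE.
      have [a [b [pE _ _ _]]] := linkP uS pl.
      by rewrite lp /cover big_set1 pE cards2; case: (a != b).
    move=> l1; have /eqP -> : link u == set0.
      by rewrite -cards_eq0; clear -lu l1; case: #|link u| lu l1 => [|[]].
    by rewrite /cover big_set0 cards0.
  by have := leq_card_setD S (cover (link u)); rewrite -/X cS; clear -ht; lia.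
have XS s : s \in X -> s \in S by rewrite inE => /andP[].
have mate s : s \in X -> exists2 v, v \notin S & [set u; v; s] \in E.
  move=> sX; have sS := XS s sX; have us := outside_neq uS sS.
  have [e eE /andP[ue se]] := hcov uG (fintype.subsetP SG _ sS) us.
  have [z ez] := edge_third eE ue se us; exists z; last by rewrite set3AC -ez.
  apply/negP => zS; move: sX; rewrite inE => /andP[/bigcupP[]]; exists [set s; z].
    by apply: link_edge => //; rewrite -ez.
  by rewrite !inE eqxx.
have /card_gt0P[s1 s1X] : 0 < #|X| by apply: leq_trans cX.
have [v vS uvs1] := mate s1 s1X.
have uvX s : s \in X -> [set u; v; s] \in E.
  have [-> //|ss1 sX] := eqVneq s s1; have [w wS uws] := mate s sX.
  rewrite eq_sym in ss1.
  by rewrite (partner_unique uS vS wS (XS _ s1X) (XS _ sX) ss1 uvs1 uws).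
have no_link x y : x \notin S -> y \notin S ->
    {in X, forall s, [set x; y; s] \in E} -> link y = set0.
  move=> xS yS xyX; apply/eqP/set0Pn => -[p /(linkP yS)[a [b [_ aS bS yab]]]].
  have /fintype.subsetPn[s sX] : ~~ (X \subset [set a; b]).
    apply/negP => /subset_leq_card; rewrite cards2; clear -cX.
    by case: (a != b); lia.
  rewrite !inE negb_or => /andP[sa sb].
  exact: (partner_link xS yS (XS _ sX) aS bS sa sb (xyX s sX) yab).
have lv : link v = set0 by apply: no_link uvX.
have lu0 : link u = set0.
  by apply: no_link vS uS _ => s sX; rewrite set3C uvX.
exists v; split => // s sS; apply: uvX.
by rewrite inE sS lu0 /cover big_set0 inE.
Qed.

(** [A] is [S] with the vertex having several link pairs, if any, and [phi] is the partner map. An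
    edge leaving [A] at [u] and meeting [S] has [phi u] as third vertex. One leaving [A] at [u] and
    disjoint from [S] has a second vertex [y] outside [A]; if it contained neither [phi u] nor
    [phi y], [partners_chain] would give a cycle. *)
Lemma core_and_pairs : exists (A : {set T}) (phi : T -> T),
  [/\ A \subset verts G, #|A| <= 2 * t - 1,
    {in verts G :\: A, forall u,
      [/\ phi u \in verts G :\: A, phi u != u & phi (phi u) = u]} &
    {in E, forall e : {set T}, e \subset A \/
      exists2 u, u \in verts G :\: A & (u \in e) && (phi u \in e)}].
Proof.
pose special := [set w in verts G :\: S | 1 < #|link w|].
pose A := S :|: special.
(* The default does not occur on [verts G :\: A], where [phiP] below supplies a partner. *)
pose phi u := odflt u
  [pick v | (v \notin S) && [forall s in S, [set u; v; s] \in E]].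
have special_eq x y : x \in special -> y \in special -> x = y.
  rewrite !inE -!andbA => /and3P[xS _ /card_gt1P[p [q [pl ql pq]]]].
  move=> /and3P[yS _ /card_gt1P[r [_ [rl _ _]]]].
  apply/eqP/contraT => xy; case/eqP: pq.
  by rewrite (link_eq xS yS xy pl rl) (link_eq xS yS xy ql rl).
have outA u : u \in verts G :\: A ->
    [/\ u \in verts G, u \notin S & #|link u| <= 1].
  rewrite !inE negb_or => /andP[/andP[uS + uG]].
  by rewrite uS uG /= -leqNgt.
have two_in_S s : exists2 s', s' \in S & s != s'.
  have /card_gt0P[s'] : 0 < #|S :\ s|.
    by have := cardsD1 s S; rewrite cS; clear -ht; case: (s \in S) => /=; lia.
  by rewrite !inE eq_sym => /andP[ss' s'S]; exists s'.
have phiP u : u \in verts G :\: A -> [/\ phi u \notin S, link u = set0,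
    link (phi u) = set0, {in S, forall s, [set u; phi u; s] \in E} &
    forall w s, w \notin S -> s \in S -> [set u; w; s] \in E -> w = phi u].
  case/outA => uG uS lu; have [v [vS lu0 lv uvS]] := partner_exists uG uS lu.
  have uniq_v w s : w \notin S -> s \in S -> [set u; w; s] \in E -> w = v.
    move=> wS sS uws; have [s' s'S ss'] := two_in_S s.
    exact: partner_unique uS wS vS sS s'S ss' uws (uvS _ s'S).
  suff -> : phi u = v by split.
  rewrite /phi; case: pickP => [w /andP[wS /forall_inP uwS]|/(_ v)] /=.
    have /card_gt0P[s sS] : 0 < #|S| by rewrite cS; clear -ht; lia.
    exact: uniq_v wS sS (uwS s sS).
  have -> : [forall s in S, [set u; v; s] \in E] by apply/forall_inP.
  by rewrite vS.
have phiA u : u \in verts G :\: A -> phi u \in verts G :\: A.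
  move=> uA; have [pS _ lp uE _] := phiP u uA.
  have /card_gt0P[s sS] : 0 < #|S| by rewrite cS; clear -ht; lia.
  rewrite !inE negb_or pS lp cards0 andbF /=.
  by apply: edge_verts (uE s sS) _; rewrite !inE eqxx orbT.
have phiK u : u \in verts G :\: A -> phi (phi u) = u.
  move=> uA; have [pS _ _ uE _] := phiP u uA; have [_ uS _] := outA u uA.
  have /card_gt0P[s sS] : 0 < #|S| by rewrite cS; clear -ht; lia.
  have [_ _ _ _ uniq_p] := phiP _ (phiA u uA).
  by apply/esym/(uniq_p u s) => //; rewrite set3C uE.
exists A, phi; split.
- rewrite finset.subUset SG; apply/fintype.subsetP => x.
  by rewrite !inE => /andP[/andP[]].
- have c1 : #|special| <= 1 by apply/card_le1_eqP => x y xs ys; apply: special_eq.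
  by have := cardsUI S special; rewrite -/A cS; clear -ht c1; lia.
- move=> u uA; have [pS _ _ uE _] := phiP u uA.
  have [_ uS _] := outA u uA.
  have /card_gt0P[s sS] : 0 < #|S| by rewrite cS; clear -ht; lia.
  split; [exact: phiA | | exact: phiK].
  by have := edge_uniq (uE s sS); rewrite eq_sym => /andP[].
move=> e eE; have [|/fintype.subsetPn[u ue uA]] := boolP (e \subset A).
  by left.
right; have uGA : u \in verts G :\: A by rewrite inE uA (edge_verts eE ue).
have [pS lu _ uE uniq_p] := phiP u uGA; have [uG uS _] := outA u uGA.
have [/existsP[s /andP[se sS]]|/existsPn eS] :=
    boolP [exists s, (s \in e) && (s \in S)].
  have us := outside_neq uS sS.
  have [z ez] := edge_third eE ue se us.
  exists u; rewrite // ue /=.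
  have zS : z \notin S.
    apply/negP => zS; have : [set s; z] \in link u.
      by apply: link_edge; rewrite -?ez.
    by rewrite lu inE.
  have uzs : [set u; z; s] \in E by rewrite set3AC -ez.
  by rewrite -(uniq_p z s zS sS uzs) ez !inE eqxx orbT.
have nS y : y \in e -> y \notin S by move=> ye; have := eS y; rewrite ye.
(* The two other vertices of [e] avoid [S], and [special] has room for only one of them. *)
have [y] : exists2 y, y \in e :\ u & y \notin A.
  apply/fintype.subsetPn/negP => euA.
  have : e :\ u \subset special.
    apply/fintype.subsetP => y yeu; have := fintype.subsetP euA y yeu.
    by move: yeu; rewrite !(inE, in_setU) => /andP[_ /nS/negPf ->].
  move/subset_leq_card; have : #|special| <= 1.
    by apply/card_le1_eqP => x y xs ys; apply: special_eq.
  have := cardsD1 u e; rewrite ue (eqP (forall_inP hG e eE)).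
  by clear; lia.
rewrite inE inE => /andP[yu ye] yA.
have yGA : y \in verts G :\: A by rewrite inE yA (edge_verts eE ye).
have [pyS _ _ yE _] := phiP y yGA.
have [pue|pue] := boolP (phi u \in e); first by exists u; rewrite // ue.
have [pye|pye] := boolP (phi y \in e); first by exists y; rewrite // ye.
have uy : u != y by rewrite eq_sym.
have [z ez] := edge_third eE ue ye uy.
have /and3P[_ uz yz] : [&& u != y, u != z & y != z].
  by apply: edge_uniq; rewrite -ez.
have zS : z \notin S by apply: nS; rewrite ez !inE eqxx orbT.
have pupy : phi u != phi y.
  by apply: contra_neq yu => puy; rewrite -(phiK _ yGA) -puy phiK.
exfalso; apply: (@partners_chain u (phi u) y (phi y) z) => //; last first.
- by rewrite set3AC -ez.
- by rewrite /= pS uS zS pyS (nS y ye).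
move: pue pye; rewrite ez !inE !negb_or => /andP[/andP[pu1 pu2] pu3].
move=> /andP[/andP[py1 py2] py3] /=; rewrite !inE !negb_or.
rewrite pu1 pu2 pu3 pupy uz uy (eq_sym z) yz (eq_sym z) py3.
by rewrite (eq_sym u) py1 (eq_sym y) py2.
Qed.

End CliqueMinusEdge.

(** * Bounds on Lagrangians *)

Lemma ler_sum_subset (R : numDomainType) (I : finType) (A B : {set I})
    (F : I -> R) : A \subset B -> {in B, forall i, 0 <= F i} ->
  \sum_(i in A) F i <= \sum_(i in B) F i.
Proof.
move=> AB F0; rewrite [leRHS](big_setID A) (setIidPr AB) lerDl.
by apply: sumr_ge0 => i; rewrite inE => /andP[_]; apply: F0.
Qed.

Lemma ler_sum_imset (R : numDomainType) (I J : finType) (h : I -> J)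
    (A : {set I}) (B : {set J}) (F : J -> R) :
    {in A &, injective h} -> {in A, forall i, h i \in B} ->
    {in B, forall j, 0 <= F j} ->
  \sum_(i in A) F (h i) <= \sum_(j in B) F j.
Proof.
move=> hinj hB F0; rewrite -(big_imset F hinj).
apply: ler_sum_subset => //; apply/fintype.subsetP => _ /imsetP[i iA ->].
exact: hB.
Qed.

Lemma imset_inj_in (I J : finType) (h : I -> J) (A e e' : {set I}) :
    {in A &, injective h} -> e \subset A -> e' \subset A -> h @: e = h @: e' ->
  e = e'.
Proof.
move=> hinj eA e'A he.
have sub (x y : {set I}) :
    x \subset A -> y \subset A -> h @: x = h @: y -> x \subset y.
  move=> /fintype.subsetP xA /fintype.subsetP yA hxy.
  apply/fintype.subsetP => i ix.
  have : h i \in h @: y by rewrite -hxy; apply: imset_f.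
  by case/imsetP => k ky /hinj -> //; [apply: xA | apply: yA].
by apply/eqP; rewrite finset.eqEsubset (sub e e') ?(sub e' e).
Qed.

(** The polynomial is homogeneous of degree 3: dividing [y] by its total and numbering the vertices
    of [A] yields a weighting of the complete 3-graph. *)
Lemma sum_prod_le_complete (R : realType) (T : finType) (P : {set {set T}})
    (A : {set T}) (m : nat) (y : T -> R) :
    (#|A| <= m)%N -> {in A, forall i, 0 <= y i} ->
    {in P, forall e : {set T}, e \subset A /\ #|e| = 3%N} ->
  \sum_(e in P) \prod_(i in e) y i <=
    lagrangian R (complete_hypergraph 3 m) * (\sum_(i in A) y i) ^+ 3.
Proof.
move=> cA y0 PA; set al := \sum_(i in A) y i.
have al_ge0 : 0 <= al by apply: sumr_ge0.
have [al0|al_neq0] := eqVneq al 0.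
  have yA0 i : i \in A -> y i = 0.
    move=> iA; apply/eqP; rewrite eq_le y0 // andbT -al0 /al (bigD1 i) //= lerDl.
    by apply: sumr_ge0 => j /andP[jA _]; apply: y0.
  rewrite al0 expr0n mulr0 big1 // => e /PA[eA e3].
  have /card_gt0P[i ie] : (0 < #|e|)%N by rewrite e3.
  by rewrite (bigD1 i) //= yA0 ?mul0r // (fintype.subsetP eA).
have al_gt0 : 0 < al by rewrite lt_def al_neq0.
case: m cA => [|m] cA.
  by move: al_neq0; rewrite /al (cards0_eq (A := A)) ?big_set0 ?eqxx //; lia.
pose g i : 'I_m.+1 := inord (index i (enum A)).
have ginj : {in A &, injective g}.
  move=> i j iA jA /(congr1 val) /=; rewrite !inordK.
  - by apply: (@index_inj _ i (enum A)); rewrite mem_enum.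
  - by apply: leq_trans cA; rewrite cardE index_mem mem_enum.
  - by apply: leq_trans cA; rewrite cardE index_mem mem_enum.
(* At most one [i] contributes to each sum, and indices outside the image of [A] get weight 0. *)
pose z j : R := \sum_(i in A | g i == j) y i / al.
have zg i : i \in A -> z (g i) = y i / al.
  move=> iA; rewrite /z (big_pred1 i) // => j /=.
  by apply/andP/eqP => [[jA /eqP/ginj->]|->].
have z0 j : 0 <= z j.
  by apply: sumr_ge0 => i /andP[iA _]; rewrite divr_ge0 ?y0.
have wz : weighting (complete_hypergraph 3 m.+1) z.
  split=> [j _|]; first exact: z0.
  rewrite /= (eq_bigl xpredT) => [|j]; last by rewrite inE.
  by rewrite -partition_big // -mulr_suml divff.
rewrite -ler_pdivrMr ?exprn_gt0 // mulr_suml.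
apply: le_trans (lagrangian_ub wz); rewrite /lagrange_poly.
pose F (e : {set 'I_m.+1}) := \prod_(j in e) z j.
rewrite (eq_bigr (fun e : {set T} => F (g @: e))); last first.
  move=> e /PA[eA e3].
  have einj : {in e &, injective g}.
    by move=> i j ie je; apply: ginj; apply: (fintype.subsetP eA).
  rewrite /F big_imset //= [RHS](eq_bigr (fun i => y i / al)); last first.
    by move=> i ie; apply: zg; apply: (fintype.subsetP eA).
  by rewrite big_split /= prodr_const e3 exprVn.
apply: ler_sum_imset => [e e' /PA[eA _] /PA[e'A _]|e /PA[eA e3]|e _].
- by move=> he; apply: (imset_inj_in ginj eA e'A he).
- rewrite /= inE card_in_imset ?e3 // => i j ie je.
  by apply: ginj; apply: (fintype.subsetP eA).
- exact: prodr_ge0.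
Qed.

(** Equal weights give (m - 1)(m - 2) / (6 m^2), which is at least 1/16 because (m - 4)(5m - 4) >=
    0. *)
Lemma complete3_lagrangian_ge (R : realType) (m : nat) : (5 <= m)%N ->
  16^-1 <= lagrangian R (complete_hypergraph 3 m).
Proof.
move=> m5; pose x (i : 'I_m) : R := m%:R^-1.
have m0 : 0 < m%:R :> R by rewrite ltr0n; lia.
have wx : weighting (complete_hypergraph 3 m) x.
  split=> [i _|]; first by rewrite invr_ge0 ltW.
  by rewrite /x /= sumr_const cardsT card_ord -[LHS]mulr_natr mulVf ?gt_eqF.
apply: le_trans (lagrangian_ub wx).
have -> : lagrange_poly (complete_hypergraph 3 m) x = 'C(m, 3)%:R / m%:R ^+ 3.
  rewrite /lagrange_poly (eq_bigr (fun=> m%:R ^- 3)); last first.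
    by move=> e; rewrite inE => /eqP e3; rewrite prodr_const e3 exprVn.
  by rewrite sumr_const /= card_draws card_ord -[LHS]mulr_natl.
rewrite ler_pdivlMr ?exprn_gt0 // ler_pdivrMl // -natrX -natrM ler_nat.
have := bin_ffact m 3; rewrite (_ : 3`! = 6)%N //.
have [k ->] : exists k, m = (k + 5)%N by exists (m - 5)%N; lia.
rewrite !ffactnS ffactn0 !addnS /= addn0 muln1 => C6.
by rewrite -(leq_pmul2l (m := 6)) //; nia.
Qed.

Lemma prod_set3 (R : comPzRingType) (T : finType) (x : T -> R) (u v w : T) :
    [&& u != v, u != w & v != w] ->
  \prod_(i in [set u; v; w]) x i = x u * x v * x w.
Proof.
move=> /and3P[uv uw vw].
rewrite finset.setUC big_setU1 ?inE ?negb_or ?(eq_sym w) ?uw //=.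
by rewrite big_setU1 ?inE //= big_set1 mulrC.
Qed.

(* [a b (1 - a - b) <= p^2 (1 - p) / 4] with [p = a + b], and [p (1 - p) <= 1/4]. *)
Lemma pair_weight_le (R : realFieldType) (a b : R) :
  0 <= a -> 0 <= b -> a + b <= 1 -> a * b * (1 - a - b) <= (a + b) / 16.
Proof.
move=> a0 b0 ab1; pose p := a + b.
have h1 : a * b <= p ^+ 2 / 4 by rewrite /p; have := sqr_ge0 (a - b); nra.
have h2 : p * (1 - p) <= 4^-1 by have := sqr_ge0 (p - 2^-1); nra.
have p0 : 0 <= p by exact: addr_ge0.
have q0 : 0 <= 1 - p by rewrite subr_ge0.
have -> : 1 - a - b = 1 - p by rewrite /p; ring.
apply: (@le_trans _ _ (p ^+ 2 / 4 * (1 - p))); first exact: ler_wpM2r.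
have -> : p ^+ 2 / 4 * (1 - p) = p / 4 * (p * (1 - p)) by field.
have -> : (a + b) / 16 = p / 4 * 4^-1 by rewrite /p; field.
by apply: ler_wpM2l => //; rewrite divr_ge0.
Qed.

Lemma lagrangian_le_core (R : realType) (T : finType) (G : hypergraph T)
    (A : {set T}) (phi : T -> T) (m : nat) :
    uniform 3 G -> verts G != set0 -> (5 <= m)%N ->
    A \subset verts G -> (#|A| <= m)%N ->
    {in verts G :\: A, forall u,
      [/\ phi u \in verts G :\: A, phi u != u & phi (phi u) = u]} ->
    {in edges G, forall e : {set T}, e \subset A \/
      exists2 u, u \in verts G :\: A & (u \in e) && (phi u \in e)} ->
  lagrangian R G <= lagrangian R (complete_hypergraph 3 m).
Proof.
move=> hG /(lagrangian_attained R)[x [x0 x1] <-] m5 AV cA phiP edgeP.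
set W := verts G :\: A in phiP edgeP *.
set c := lagrangian R _; pose F (e : {set T}) := \prod_(i in e) x i.
have c16 : 16^-1 <= c by apply: complete3_lagrangian_ge.
have WV u : u \in W -> u \in verts G by rewrite inE => /andP[].
have F0 e : e \in edges G -> 0 <= F e.
  by move=> eE; apply: prodr_ge0 => i ie; apply: x0; apply: edge_verts eE ie.
pose al := \sum_(i in A) x i; pose be := \sum_(i in W) x i.
have albe : al + be = 1 by rewrite -x1 [RHS](big_setID A) (setIidPr AV).
have al0 : 0 <= al.
  by apply: sumr_ge0 => i iA; apply: x0; apply: (fintype.subsetP AV).
have be0 : 0 <= be by apply: sumr_ge0 => i /WV; apply: x0.
pose EA := [set e in edges G | e \subset A].
have -> : lagrange_poly G x = \sum_(e in EA) F e + \sum_(e in edges G :\: EA) F e.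
  rewrite /lagrange_poly (big_setID EA) /=; congr (_ + _); apply: eq_bigl => e.
  by rewrite !inE andbA andbb.
have leA : \sum_(e in EA) F e <= c * al ^+ 3.
  apply: sum_prod_le_complete => // [i iA|e].
    by apply: x0; apply: (fintype.subsetP AV).
  by rewrite inE => /andP[eE eA]; split=> //; apply/eqP/(forall_inP hG).
pose Z (e : {set T}) := [set u in W | (u \in e) && (phi u \in e)].
(* An edge not inside [A] contains some [u] of [W] with [phi u], so it is counted from both ends of
   that pair. The sum over [W] thus counts it at least twice. *)
have leB2 : (\sum_(e in edges G :\: EA) F e) *+ 2 <=
    \sum_(u in W) \sum_(e in edges G | (u \in e) && (phi u \in e)) F e.
  rewrite (exchange_big_dep (fun e => e \in edges G)) /= => [|u e _ /andP[]//].
  rewrite -sumrMnl.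
  have h1 : \sum_(e in edges G :\: EA) F e *+ 2 <=
      \sum_(e in edges G :\: EA) F e *+ #|Z e|.
    apply: ler_sum => e; rewrite !inE => /andP[+ eE]; rewrite eE /= => eA.
    apply: ler_wpMn2l; [exact: F0 | apply/card_gt1P].
    case: (edgeP e eE) => [|[u uW /andP[ue pue]]]; first by rewrite (negPf eA).
    have [pW pu ppu] := phiP u uW.
    have inZ w : (w \in Z e) = [&& w \in W, w \in e & phi w \in e].
      by rewrite [LHS]inE.
    by exists u, (phi u); rewrite !inZ uW pW ue pue ppu ue eq_sym pu.
  have h2 : \sum_(e in edges G :\: EA) F e *+ #|Z e| <=
      \sum_(e in edges G) F e *+ #|Z e|.
    apply: ler_sum_subset => [|e eE]; first exact: finset.subsetDl.
    by rewrite mulrn_wge0 ?F0.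
  apply: le_trans h1 (le_trans h2 _); rewrite le_eqVlt; apply/orP; left.
  apply/eqP/eq_bigr => e eE; rewrite -sumr_const; apply: eq_bigl => u.
  by rewrite !inE eE.
have lepair u : u \in W ->
    \sum_(e in edges G | (u \in e) && (phi u \in e)) F e <=
    (x u + x (phi u)) / 16.
  move=> uW; have [pW pu _] := phiP u uW.
  have uV := WV _ uW; have pV := WV _ pW.
  (* An edge through [u] and [phi u] is fixed by its third vertex, so these edges contribute at most
     [x u * x (phi u)] times the remaining weight. *)
  have sumQ : 1 - x u - x (phi u) = \sum_(z in verts G :\ u :\ phi u) x z.
    by rewrite -x1 (big_setD1 u) //= (big_setD1 (phi u)) ?inE ?pu //=; ring.
  have Q0 : 0 <= 1 - x u - x (phi u).
    by rewrite sumQ; apply: sumr_ge0 => z; rewrite !inE => /and3P[_ _]; apply: x0.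
  apply: le_trans (pair_weight_le _ _ _); rewrite ?x0 //; last by lra.
  rewrite sumQ mulr_sumr.
  pose h z := [set u; phi u; z].
  have hE z : z \in verts G :\ u :\ phi u -> F (h z) = x u * x (phi u) * x z.
    rewrite !inE => /and3P[zp zu _]; rewrite /F prod_set3 // eq_sym pu.
    by rewrite eq_sym zu eq_sym zp.
  rewrite -(eq_bigr _ hE).
  have hinj : {in verts G :\ u :\ phi u &, injective h}.
    move=> y z; rewrite !inE => /and3P[yp yu _] _ hyz.
    have : y \in h z by rewrite -hyz !inE eqxx orbT.
    by rewrite !inE (negPf yp) (negPf yu) => /eqP.
  rewrite -(big_imset F hinj) /= -big_set.
  apply: ler_sum_subset => [|_ /imsetP[z zQ ->]]; last first.
    rewrite hE // mulr_ge0 ?mulr_ge0 ?x0 //.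
    by move: zQ; rewrite !inE => /and3P[].
  apply/fintype.subsetP => e; rewrite inE => /and3P[eE ue pe].
  have up : u != phi u by rewrite eq_sym.
  have [z ez] := edge_third hG eE ue pe up.
  have /and3P[_ uz pz] : [&& u != phi u, u != z & phi u != z].
    by apply: (edge_uniq hG); rewrite -ez.
  apply/imsetP; exists z => //; rewrite !inE eq_sym pz eq_sym uz.
  by apply: edge_verts eE _; rewrite ez !inE eqxx orbT.
have leB : \sum_(e in edges G :\: EA) F e <= be / 16.
  (* [phi] is an involution of [W], so summing [x u + x (phi u)] over [W] gives at most [2 * be];
     the factor 2 cancels the double counting. *)
  have hphi : \sum_(u in W) x (phi u) <= be.
    apply: ler_sum_imset => [u v uW vW puv|u /phiP[]//|u /WV]; last exact: x0.
    by have [_ _ <-] := phiP u uW; have [_ _ <-] := phiP v vW; rewrite puv.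
  have := le_trans leB2 (ler_sum _ lepair).
  rewrite -mulr_suml big_split /= -/be mulr2n; lra.
have al1 : al <= 1 by lra.
have cal : c * al ^+ 3 <= c * al.
  have c0 : 0 <= c by apply: le_trans c16; rewrite invr_ge0.
  by apply: ler_wpM2l => //; rewrite exprS ler_piMr // exprn_ile1.
have bec : be / 16 <= be * c by apply: ler_wpM2l.
have cE : c * al + be * c = c by rewrite mulrC -mulrDl albe mul1r.
lra.
Qed.

(** * Optimal weightings of dense hypergraphs *)

Lemma dense_weight_neq0 (R : realType) (T : finType) (G : hypergraph T)
    (x : T -> R) (v : T) :
    lagrangian_dense R G -> v \in verts G -> weighting G x -> x v = 0 ->
  lagrange_poly G x < lagrangian R G.
Proof.
move=> dG vG [x0 x1] xv0.
(* Deleting [v] gives [H]: as [x] vanishes at [v], it is a weighting of [H] of the same value, and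
   density makes the Lagrangian of [H] smaller. *)
have HV : [set e in edges G | v \notin e] \subset powerset (verts G :\ v).
  apply/fintype.subsetP => e; rewrite inE powersetE => /andP[eE ve].
  apply/fintype.subsetP => i ie; rewrite !inE (edge_verts eE ie) andbT.
  by apply: contraNneq ve => <-.
pose H := Hypergraph HV.
have pH : proper_subgraph H G.
  rewrite /proper_subgraph /subgraph /= finset.subsetDl /=; apply/andP; split.
    by apply/fintype.subsetP => e; rewrite inE => /andP[].
  rewrite negb_and; apply/orP; left; apply/fintype.subsetPn; exists v => //.
  by rewrite !inE eqxx.
have wH : weighting H x.
  split=> [i|]; first by rewrite /= !inE => /andP[_ /x0].
  by rewrite -x1 /= [RHS](big_setD1 v) //= xv0 add0r.
apply: le_lt_trans (dG H pH); apply: le_trans (lagrangian_ub wH).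
rewrite /lagrange_poly (big_setID [set e in edges G | v \notin e]) /=.
rewrite [X in _ + X]big1 => [|e].
  rewrite addr0 le_eqVlt; apply/orP; left; apply/eqP; apply: eq_bigl => e.
  by rewrite !inE; case: (e \in edges G).
rewrite !inE => /andP[+ eE]; rewrite eE negbK => ve.
by rewrite (bigD1 v) //= xv0 mul0r.
Qed.

(** For an uncovered pair, an optimal weighting could be changed into an optimal one vanishing at a
    vertex, against [dense_weight_neq0]. *)
Lemma dense_covering (R : realType) (T : finType) (G : hypergraph T) :
    lagrangian_dense R G ->
  {in verts G &, forall u v, u != v ->
    exists2 e, e \in edges G & (u \in e) && (v \in e)}.
Proof.
move=> dG u v uG vG uv; apply/exists_inP; apply: contraT => /exists_inPn noe.
have V0 : verts G != set0 by apply/set0Pn; exists u.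
have [x [x0 x1] xmax] := lagrangian_attained R V0.
pose D w := \sum_(e in edges G | w \in e) \prod_(i in e :\ w) x i.
(* No edge contains both vertices, so moving all their weight to the one with
   the larger partial derivative [D] does not decrease the polynomial. *)
wlog Dle : u v uG vG uv noe / D v <= D u.
  move=> W; case: (leP (D v) (D u)) => [|/ltW] Dle; first exact: (W u v).
  by apply: (W v u) => //; [rewrite eq_sym | move=> e eE; rewrite andbC noe].
pose y i := if i == u then x u + x v else if i == v then 0 else x i.
(* No term contains both [z u] and [z v], so the polynomial is affine in these two weights, with
   coefficients [D u] and [D v]. *)
have polyE z : (forall i, i != u -> i != v -> z i = x i) ->
    lagrange_poly G z = z u * D u + (z v * D v +
      \sum_(e in edges G | (u \notin e) && (v \notin e)) \prod_(i in e) x i).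
  move=> zx; rewrite /lagrange_poly (bigID (fun e : {set T} => u \in e)) /=.
  rewrite [X in _ + X](bigID (fun e : {set T} => v \in e)) /=.
  have part w w' :
      {in edges G, forall e : {set T}, ~~ ((w \in e) && (w' \in e))} ->
      (forall i, i != w -> i != w' -> z i = x i) ->
      \sum_(e in edges G | w \in e) \prod_(i in e) z i = z w * D w.
    move=> now zw; rewrite mulr_sumr; apply: eq_bigr => e /andP[eE we].
    rewrite (big_setD1 w) //=; congr (_ * _); apply: eq_bigr => i.
    rewrite !inE => /andP[iw ie]; apply: zw => //.
    by apply: contraNneq (now e eE) => <-; rewrite we.
  rewrite (part u v) //; congr (_ + (_ + _)).
    rewrite -(part v u); first last.
    - by move=> i iv iu; apply: zx.
    - by move=> e eE; rewrite andbC noe.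
    apply: eq_bigl => e; case eE: (e \in edges G) => //=.
    by have := noe e eE; case: (u \in e); case: (v \in e).
  apply: eq_big => e; first by rewrite andbA.
  move=> /andP[/andP[eE ue] ve]; apply: eq_bigr => i ie; apply: zx.
    by apply: contraNneq ue => <-.
  by apply: contraNneq ve => <-.
have vu : (v == u) = false by rewrite eq_sym (negPf uv).
have yv : y v = 0 by rewrite /y vu eqxx.
have yu : y u = x u + x v by rewrite /y eqxx.
have yx i : i != u -> i != v -> y i = x i.
  by move=> iu iv; rewrite /y (negPf iu) (negPf iv).
have wy : weighting G y.
  split=> [i iG|].
    rewrite /y; case: ifP => _; first by rewrite addr_ge0 ?x0.
    by case: ifP => // _; apply: x0.
  have vGu : v \in verts G :\ u by rewrite !inE vu.
  rewrite -x1 !(big_setD1 u uG) /= !(big_setD1 v vGu) /= yu yv add0r addrA.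
  congr (_ + _); apply: eq_bigr => i; rewrite !inE => /and3P[iv iu _].
  exact: yx.
have := dense_weight_neq0 dG vG wy yv.
(* The value at [y] exceeds that at [x] by [x v * (D u - D v)], which is nonnegative, so the strict
   inequality is absurd. *)
rewrite -xmax (polyE x) // (polyE y) // yu yv mul0r add0r mulrDl -addrA.
rewrite ltrD2l ltrD2r.
by rewrite ltNge ler_wpM2l // x0.
Qed.

Theorem theorem1p12 (R : realType) (t : nat) (T : finType) (G : hypergraph T)
    (ht : (4 <= t)%N)
    (hG : uniform 3 G)
    (hdense : lagrangian_dense R G)
    (hfree : copy_free (linear_cycle3 t) G)
    (hcopy : has_copy (complete3_minus (2 * t - 2)) G) :
  lagrangian R G <= lagrangian R (complete_hypergraph 3 (2 * t - 1)).
Proof.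
have [H /andP[HV HE] [g [ginj gV gE]]] := hcopy.
have gi : injective g by move=> i j; apply: ginj; rewrite inE.
pose f0 := [set v : 'I_(2 * t - 2) | (v < 3)%N].
pose S := verts H.
have cS : #|S| = (2 * t - 2)%N by rewrite /S -gV card_imset // cardsT card_ord.
have f3 : #|g @: f0| = 3%N.
  rewrite card_imset //.
  have l3 : (3 <= 2 * t - 2)%N by lia.
  have -> : f0 = [set widen_ord l3 i | i in 'I_3].
    apply/setP => v; rewrite inE; apply/idP/imsetP => [v3|[i _ ->]].
      by exists (Ordinal v3); last exact: val_inj.
    by rewrite /= ltn_ord.
  by rewrite card_imset ?card_ord // => i j /(congr1 val) /= /val_inj.
have fS : g @: f0 \subset S.
  by rewrite /S -gV; apply: imsetS; apply: finset.subsetT.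
have SE (e : {set T}) :
    e \subset S -> #|e| = 3%N -> e != g @: f0 -> e \in edges G.
  move=> eS e3 ef; apply: (fintype.subsetP HE); rewrite -gE.
  (* Since [g] maps onto [S], each triple of [S] is the image of a triple of indices, which is an
     edge of [complete3_minus] unless it is [f0]. *)
  have ge : g @: (g @^-1: e) = e.
    apply/setP => y; apply/imsetP/idP => [[i + ->]|ye]; first by rewrite inE.
    have : y \in g @: verts (complete3_minus (2 * t - 2)).
      by rewrite gV; apply: (fintype.subsetP eS).
    by case/imsetP => i _ yi; exists i; rewrite // inE -yi.
  apply/imsetP; exists (g @^-1: e) => //.
  rewrite !inE -(card_imset _ gi) ge e3 eqxx andbT.
  by apply: contraNneq ef => gef; rewrite -[X in X == _]ge gef.
have SG : S \subset verts G := HV.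
have [A [phi [AV cA phiP edgeP]]] :=
  core_and_pairs ht hG hfree (dense_covering hdense) SG cS fS f3 SE.
apply: lagrangian_le_core hG _ _ AV cA phiP edgeP; last by lia.
have /card_gt0P[s sS] : (0 < #|S|)%N by rewrite cS; lia.
by apply/set0Pn; exists s; apply: (fintype.subsetP SG).
Qed.
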